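(* Let $n,m,l$ be positive integers with $l\le m<n$, and let $k$ be the positive integer with $km<n\le(k+1)m$. Let $A\in\mathcal{T}(n,m)$, $A\ne0$, be $A=A(a,\alpha)+a_0I_{n\times m}$ and let $B\in\mathcal{T}(m,l)$, $B\neq0$, be $B=A(b,\beta)+b_0I_{m\times l}$, where $a=(0,a_1,\dots,a_{n-1})^T$, $\alpha=(0,\alpha_1,\dots,\alpha_{m-1})^T$, $b=(0,b_1,\dots,b_{m-1})^T$, $\beta=(0,\beta_1,\dots,\beta_{l-1})^T$. Then $AB\in\mathcal{T}(n,l)$ if and only if at least one of the following conditions holds: (1) $B$ is the asymmetric Toeplitz matrix with first column $(b_0,b_1,\dots,b_{m-l},0,\dots,0)^T$ and first row $(b_0,0,\dots,0)$ (that is, $\beta=0$ and $b_i=0$ for $m-l+1\le i\le m-1$). (2) There is $\lambda\in\hat{\mathbb{C}}=\mathbb{C}\cup\{\infty\}$ such that $A$ has form $(\mathrm{a}_\lambda)$ and $B=A(b,\tfrac{1}{\overline{\lambda}}\hat{b}_{(m,l)})+b_0I_{m\times l}$, with the following meaning. For $\lambda\in\mathbb{C}\setminus\{0\}$: $(\mathrm{a}_\lambda)$ says that $A$ is the asymmetric Toeplitz matrix with first row $(a_0,\tfrac1\lambda a_{m-1},\tfrac1\lambda a_{m-2},\dots,\tfrac1\lambda a_1)$ and first column $(a_0,a_1,\dots,a_{m-1},\lambda a_0,\dots,\lambda a_{m-1},\dots,\lambda^k a_0,\dots,\lambda^k a_{n-km-1})^T$, and $\beta=\tfrac1{\overline\lambda}\hat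 b_{(m,l)}$. For $\lambda=0$: $A=A(0,\alpha)+a_0I_{n\times m}$, i.e. $a=0$, and $\hat{b}_{(m,l)}=0$ with $\beta$ unrestricted (so $B$ has first column $(b_0,b_1,\dots,b_{m-l},0,\dots,0)^T$ and first row $(b_0,\overline{\beta}_1,\dots,\overline{\beta}_{l-1})$). For $\lambda=\infty$: $A$ has first row $0$ and first column $(0,\dots,0,a_{n-m},\dots,a_{n-1})^T$, i.e. $a_0=0$, $\alpha=0$ and $a_i=0$ for $1\le i\le n-m-1$, and $B=A(b,0)+b_0I_{m\times l}$, i.e. $\beta=0$.
   Context: Matrices are complex; rows and columns of an $n\times m$ matrix are numbered $0,\dots,n-1$ and $0,\dots,m-1$. An asymmetric Toeplitz matrix is an $n\times m$ matrix constant along each diagonal (hence determined by its first row and first column); $\mathcal{T}(n,m)$ is the set of all of them. For $a=(0,a_1,\dots,a_{n-1})^T\in\mathbb{C}^n$ and $\alpha=(0,\alpha_1,\dots,\alpha_{m-1})^T\in\mathbb{C}^m$, $A(a,\alpha)$ is the $n\times m$ matrix whose $(i,j)$ entry is $a_{i-j}$ if $i>j$, $0$ if $i=j$, and $\overline{\alpha}_{j-i}$ if $i<j$. $I_{n\times m}$ is the $n\times m$ matrix with $(i,j)$ entry $1$ if $i=j$ and $0$ otherwise. Every $A\in\mathcal{T}(n,m)$ is uniquely $A=A(a,\alpha)+a_0I_{n\times m}$ with $a_0\in\mathbb{C}$. For $l\le m$ put $\hat{b}_{(m,l)}=(0,\overline{b}_{m-1},\dots,\overline{b}_{m-l+1})^T\in\mathbb{C}^l$.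 *)

(* Defs.v *)
From mathcomp Require Import all_boot all_order all_algebra.
From mathcomp Require Import complex.
From mathcomp Require Import reals.

Set Implicit Arguments.
Unset Strict Implicit.
Unset Printing Implicit Defensive.

Import Order.TTheory GRing.Theory Num.Theory.
Local Open Scope ring_scope.

(* The set T(n, m); [i + j' = i' + j] is the subtraction-free form of
   [i - j = i' - j']. *)
Definition is_toeplitz (C : numClosedFieldType) (n m : nat)
    (A : 'M[C]_(n, m)) : Prop :=
  forall (i i' : 'I_n) (j j' : 'I_m), (i + j' = i' + j)%N -> A i j = A i' j'.

Definition toeplitz_with (C : numClosedFieldType) (n m : nat)
    (c : 'cV[C]_n) (r : 'rV[C]_m) (A : 'M[C]_(n, m)) : Prop :=
  [/\ is_toeplitz A,
      forall (i : 'I_n) (j : 'I_m), j = 0%N :> nat -> A i j = c i 0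
    & forall (i : 'I_n) (j : 'I_m), i = 0%N :> nat -> A i j = r 0 j].

(* Entry of index [i : nat] of a column vector; the junk value 0 for [n <= i]
   is never reached below. *)
Definition cvcoef (C : numClosedFieldType) (n : nat) (v : 'cV[C]_n) (i : nat) : C :=
  if insub i is Some j then v j 0 else 0.

(* The sequence a_0, a_1, ..., a_(n-1), where a = (0, a_1, ..., a_(n-1))^T and
   the scalar a_0 is kept apart. *)
Definition fullcoef (C : numClosedFieldType) (n : nat) (a0 : C) (a : 'cV[C]_n)
    (i : nat) : C :=
  if i == 0%N then a0 else cvcoef a i.

(* A(a, alpha) *)
Definition toepmx (C : numClosedFieldType) (n m : nat)
    (a : 'cV[C]_n) (alpha : 'cV[C]_m) : 'M[C]_(n, m) :=
  \matrix_(i < n, j < m)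
    if (j < i)%N then cvcoef a (i - j)
    else if (i < j)%N then (cvcoef alpha (j - i))^* else 0.

(* I_(n x m) *)
Definition rect_idmx (C : numClosedFieldType) (n m : nat) : 'M[C]_(n, m) :=
  \matrix_(i < n, j < m) (i == j :> nat)%:R.
Arguments rect_idmx {C} n m.

(* \hat b_(m, l), for l <= m *)
Definition hatv (C : numClosedFieldType) (m l : nat) (b : 'cV[C]_m) : 'cV[C]_l :=
  \col_(i < l) if i == 0%N :> nat then 0 else (cvcoef b (m - i))^*.
Arguments hatv {C m} l b.

Definition B_lower_banded (C : numClosedFieldType) (m l : nat) (b : 'cV[C]_m) (b0 : C)
    (B : 'M[C]_(m, l)) : Prop :=
  toeplitz_with (\col_(i < m) if (i <= m - l)%N then fullcoef b0 b i else 0)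
                (\row_(j < l) if j == 0%N :> nat then b0 else 0) B.

(* The extended plane C u {oo} is [option C], with [None] for oo.  In the
   generic case the first column has entry lambda^q a_r at index q m + r, with
   r < m; for indices below n <= (k + 1) m the quotient q is at most k. *)
Definition A_has_form (C : numClosedFieldType) (n m : nat) (lambda : option C)
    (a : 'cV[C]_n) (alpha : 'cV[C]_m) (a0 : C) (A : 'M[C]_(n, m)) : Prop :=
  match lambda with
  | Some x =>
      if x == 0 then A = toepmx 0 alpha + a0 *: rect_idmx n m
      else toeplitz_with
             (\col_(i < n) (x ^+ (i %/ m) * fullcoef a0 a (i %% m)))
             (\row_(j < m) if j == 0%N :> nat then a0
                           else x^-1 * cvcoef a (m - j)) A
  | None =>
      toeplitz_with (\col_(i < n) if (i < n - m)%N then 0 else fullcoef a0 a i) 0 A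
  end.

(* For lambda = 0, 1/lambda^* \hat b is read as: \hat b = 0, beta arbitrary. *)
Definition B_has_form (C : numClosedFieldType) (m l : nat) (lambda : option C)
    (b : 'cV[C]_m) (beta : 'cV[C]_l) (b0 : C) (B : 'M[C]_(m, l)) : Prop :=
  match lambda with
  | Some x =>
      if x == 0
      then hatv l b = 0 /\ B = toepmx b beta + b0 *: rect_idmx m l
      else B = toepmx b ((x^*)^-1 *: hatv l b) + b0 *: rect_idmx m l
  | None => B = toepmx b 0 + b0 *: rect_idmx m l
  end.

(* Main.v *)
Require Import Defs.
From mathcomp Require Import all_boot all_order all_algebra.
From mathcomp Require Import complex.
From mathcomp Require Import reals.
From mathcomp Require Import zify.

Import Order.TTheory GRing.Theory Num.Theory.
Local Open Scope ring_scope.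

(** Write [A i j = S (i + (m - j))] and [B j q = T (j + (l - q))], so that each
    matrix is carried by the sequence of its diagonals.  Two entries of [A *m B]
    that are adjacent on a diagonal are sums of the same products up to a shift
    of the summation index; all terms cancel except the first and the last one.
    Hence [A *m B] is Toeplitz if and only if
      [S (p + m) * T (l - q) = S p * T (m + (l - q))]
    for all [0 < p < n] and [0 < q < l] ([is_toeplitz_mulP]).

    This says that every pair [(S (p + m), S p)] is proportional to every pair
    [(T (m + (l - q)), T (l - q))].  Since [m < n], the first pairs exhaust the
    diagonals of [A], so one of them is nonzero.  Therefore either all the
    second pairs vanish, which is condition (1), or all the pairs lie on one
    common line [u = lambda w] (with [w = 0] for lambda infinite), which is
    condition (2) ([proportional_pairsP]).  The rest reads off the forms
    [A_has_form], [B_has_form] and [B_lower_banded] as conditions on [S] and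
    [T]. *)

(** * Toeplitz matrices as sequences of diagonals *)

(** The [n x m] Toeplitz matrix with diagonals listed by [S]: the index
    [i + (m - j)] is [i - j] shifted by [m], so it runs over [1, ..., n + m - 1]
    and the main diagonal has index [m]. *)
Definition diagmx_of_seq {C : numClosedFieldType} (n m : nat) (S : nat -> C) :
    'M[C]_(n, m) :=
  \matrix_(i < n, j < m) S (i + (m - j))%N.

(** The list of diagonals of [A(a, alpha) + a_0 I], from the upper right to the
    lower left corner, with the indexing of [diagmx_of_seq]. *)
Definition diagseq {C : numClosedFieldType} {n m : nat} (a0 : C) (a : 'cV[C]_n)
    (alpha : 'cV[C]_m) (d : nat) : C :=
  if (m <= d)%N then fullcoef a0 a (d - m) else (cvcoef alpha (m - d))^*.

Section Toeplitz.
Context {C : numClosedFieldType}.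
Implicit Types (S T : nat -> C).

Lemma is_toeplitzP (n m : nat) (M : 'M[C]_(n, m)) :
  is_toeplitz M <->
  forall (i i' : 'I_n) (j j' : 'I_m), i' = i.+1 :> nat -> j' = j.+1 :> nat ->
    M i' j' = M i j.
Proof.
split=> [TM i i' j j' ei ej|step]; first by apply: TM; lia.
have shift d : forall (i i' : 'I_n) (j j' : 'I_m),
    i' = (i + d)%N :> nat -> j' = (j + d)%N :> nat -> M i' j' = M i j.
  elim: d => [|d IHd] i i' j j' ei ej.
    by congr (M _ _); apply: val_inj; rewrite /= ?ei ?ej addn0.
  have hi : (i + d < n)%N by have := ltn_ord i'; lia.
  have hj : (j + d < m)%N by have := ltn_ord j'; lia.
  rewrite (step (Ordinal hi) _ (Ordinal hj)) /=; [|lia|lia].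
  exact: IHd.
move=> i i' j j' e; case: (leqP i i') => h.
- by apply/esym/(shift (i' - i)%N); lia.
- by apply: (shift (i - i')%N); lia.
Qed.

Lemma is_toeplitz_diagmx (n m : nat) S : is_toeplitz (diagmx_of_seq n m S).
Proof.
move=> i i' j j' e; rewrite !mxE; congr (S _).
by have := ltn_ord j; have := ltn_ord j'; lia.
Qed.

(** * Products and proportional pairs *)

(** The products [F p q t], for [0 <= t <= m], make up both adjacent entries:
    [t < m] gives the entry [(p, q)], and [0 < t] the entry [(p - 1, q - 1)]. *)
Lemma is_toeplitz_mulP (n m l : nat) S T :
  is_toeplitz (diagmx_of_seq n m S *m diagmx_of_seq m l T) <->
  forall (p : 'I_n) (q : 'I_l), (0 < p)%N -> (0 < q)%N ->
    S (p + m)%N * T (l - q)%N = S p * T (m + (l - q))%N.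
Proof.
pose F (p q t : nat) := S (p + (m - t))%N * T (t + (l - q))%N.
have sumF p q : \sum_(t < m) F p q t + F p q m
              = F p q 0%N + \sum_(t < m) F p q t.+1.
  transitivity (\sum_(t < m.+1) F p q t); first by rewrite big_ord_recr.
  by rewrite big_ord_recl.
have F0 p q : F p q 0%N = S (p + m)%N * T (l - q)%N by rewrite /F subn0 add0n.
have Fm p q : F p q m = S p * T (m + (l - q))%N by rewrite /F subnn addn0.
have entry (i : 'I_n) (j : 'I_l) :
    (diagmx_of_seq n m S *m diagmx_of_seq m l T) i j = \sum_(t < m) F i j t.
  by rewrite mxE; apply: eq_bigr => t _; rewrite !mxE.
have entryS (i p : 'I_n) (j q : 'I_l) : p = i.+1 :> nat -> q = j.+1 :> nat ->
    \sum_(t < m) F i j t = \sum_(t < m) F p q t.+1.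
  move=> ei ej; apply: eq_bigr => t _; rewrite /F ei ej.
  have := ltn_ord t; have := ltn_ord q => hq ht.
  by congr (S _ * T _); lia.
rewrite is_toeplitzP; split=> [step p q p0 q0|prop i p j q ei ej].
- have hi : (p.-1 < n)%N by have := ltn_ord p; lia.
  have hj : (q.-1 < l)%N by have := ltn_ord q; lia.
  have ei : p = (Ordinal hi).+1 :> nat by rewrite /=; lia.
  have ej : q = (Ordinal hj).+1 :> nat by rewrite /=; lia.
  have := step _ _ _ _ ei ej; rewrite !entry (entryS _ _ _ _ ei ej) => e.
  by have := sumF p q; rewrite e addrC F0 Fm => /addIr.
- rewrite !entry (entryS _ _ _ _ ei ej).
  have := sumF p q; rewrite F0 Fm prop ?ei ?ej // addrC.
  by move=> /addrI.
Qed.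

(** The point [(u : w)] lies on the line of slope [lambda], where [None] stands
    for the infinite slope. *)
Definition on_line (lambda : option C) (u w : C) : Prop :=
  if lambda is Some x then u = x * w else w = 0.

(** The proportionality dichotomy: if some [(u, w)] is nonzero, then either all
    [(z, v)] vanish or all pairs are on one line. *)
Lemma proportional_pairsP (I J : finType) (P : pred I) (Q : pred J)
    (u w : I -> C) (v z : J -> C) :
  (exists2 i, P i & (u i != 0) || (w i != 0)) ->
  (forall i j, P i -> Q j -> u i * v j = w i * z j) <->
  (forall j, Q j -> z j = 0 /\ v j = 0) \/
  exists lambda, (forall i, P i -> on_line lambda (u i) (w i)) /\
                 (forall j, Q j -> on_line lambda (z j) (v j)).
Proof.
move=> [i0 Pi0 nz0]; split; last first.
  case=> [vz0 i j _ /vz0[-> ->]|[[x|] /= [Hu Hv]] i j Pi Qj].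
  - by rewrite !mulr0.
  - by rewrite (Hu i) // (Hv j) // -mulrA mulrCA.
  - by rewrite (Hu i) // (Hv j) // mulr0 mul0r.
move=> prop.
have [/existsP[j0 /andP[Qj0 vj0]]|/existsPn v0] :=
  boolP [exists j, Q j && (v j != 0)].
- right; exists (Some (z j0 / v j0)) => /=.
  have Hu i : P i -> u i = z j0 / v j0 * w i.
    by move=> Pi; rewrite mulrAC [z _ * _]mulrC -prop // mulfK.
  split=> // j Qj.
  (* [w i0 = 0] would force [u i0 = 0] *)
  have wi0 : w i0 != 0.
    by apply: contraTneq nz0 => w0; rewrite Hu // w0 mulr0 eqxx.
  by apply: (mulfI wi0); rewrite -prop // Hu // -mulrA mulrCA.
have {}v0 j : Q j -> v j = 0.
  by move=> Qj; have := v0 j; rewrite Qj negbK => /eqP.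
have [/existsP[j0 /andP[Qj0 zj0]]|/existsPn z0] :=
  boolP [exists j, Q j && (z j != 0)].
- right; exists None; split=> //= i Pi.
  by apply: (mulIf zj0); rewrite -prop // v0 // mulr0 mul0r.
- left=> j Qj; split; last exact: v0.
  by have := z0 j; rewrite Qj negbK => /eqP.
Qed.

(** * The forms of the two factors, read on their diagonals *)

Lemma cvcoefE (n : nat) (v : 'cV[C]_n) (i : 'I_n) : cvcoef v i = v i 0.
Proof. by rewrite /cvcoef valK. Qed.

Lemma cvcoef0 (n i : nat) : cvcoef (0 : 'cV[C]_n) i = 0.
Proof. by rewrite /cvcoef; case: insubP => // j _ _; rewrite mxE. Qed.

Lemma cvcoefZ (n : nat) (x : C) (v : 'cV[C]_n) (i : nat) :
  cvcoef (x *: v) i = x * cvcoef v i.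
Proof. by rewrite /cvcoef; case: insubP => [j _ _|_]; rewrite ?mxE ?mulr0. Qed.

Lemma fullcoef_gt0 (n : nat) (a0 : C) (a : 'cV[C]_n) (i : nat) :
  (0 < i)%N -> fullcoef a0 a i = cvcoef a i.
Proof. by rewrite /fullcoef; case: i. Qed.

Lemma eq_cvcoef (n : nat) (v w : 'cV[C]_n) :
  cvcoef v 0 = cvcoef w 0 ->
  (forall i : 'I_n, (0 < i)%N -> cvcoef v i = cvcoef w i) -> v = w.
Proof.
move=> e0 eS; apply/colP => i; rewrite -!cvcoefE.
by case: (posnP i) => [->|/eS].
Qed.

Section DiagSeq.
Context {n m : nat}.
Implicit Types (a : 'cV[C]_n) (alpha : 'cV[C]_m).

Lemma diagseq_col (a0 : C) a alpha p : diagseq a0 a alpha (p + m) = fullcoef a0 a p.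
Proof. by rewrite /diagseq leq_addl addnK. Qed.

Lemma diagseq_row (a0 : C) a alpha q : (0 < q <= m)%N ->
  diagseq a0 a alpha (m - q) = (cvcoef alpha q)^*.
Proof.
move=> hq; rewrite /diagseq ifN; last lia.
by congr (cvcoef _ _)^*; lia.
Qed.

Lemma toepmx_diagE (a0 : C) a alpha :
  toepmx a alpha + a0 *: rect_idmx n m = diagmx_of_seq n m (diagseq a0 a alpha).
Proof.
apply/matrixP=> i j; rewrite !mxE; have := ltn_ord j => hj.
case: ltngtP => hij; rewrite ?mulr0 ?mulr1 ?addr0 ?add0r.
- have -> : (i + (m - j) = (i - j) + m)%N by lia.
  by rewrite diagseq_col fullcoef_gt0 //; lia.
- have -> : (i + (m - j) = m - (j - i))%N by lia.
  by rewrite diagseq_row //; lia.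
- have -> : (i + (m - j) = 0 + m)%N by lia.
  by rewrite diagseq_col.
Qed.

Lemma toeplitz_with_diagmxP (S : nat -> C) (c : 'cV[C]_n) (r : 'rV[C]_m) :
  (0 < n)%N -> (0 < m)%N ->
  toeplitz_with c r (diagmx_of_seq n m S) <->
  (forall i : 'I_n, S (i + m)%N = c i 0) /\
  (forall j : 'I_m, S (m - j)%N = r 0 j).
Proof.
move=> n0 m0; split=> [[_ Hc Hr]|[Hc Hr]].
- split=> [i|j].
    by rewrite -(Hc i (Ordinal m0)) // mxE subn0.
  by rewrite -(Hr (Ordinal n0) j) // mxE.
- split=> [|i j j0|i j i0].
  + exact: is_toeplitz_diagmx.
  + by rewrite mxE j0 subn0.
  + by rewrite mxE i0 add0n.
Qed.

(** The off-diagonal data of a Toeplitz matrix can be read from the matrix. *)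
Lemma toepmx_inj (a0 : C) a a' alpha alpha' : (0 < n)%N -> (0 < m)%N ->
  toepmx a alpha + a0 *: rect_idmx n m = toepmx a' alpha' + a0 *: rect_idmx n m ->
  (forall i : 'I_n, (0 < i)%N -> cvcoef a i = cvcoef a' i) /\
  (forall j : 'I_m, (0 < j)%N -> cvcoef alpha j = cvcoef alpha' j).
Proof.
move=> n0 m0 /addIr/matrixP e; split=> [i i0|j j0].
  by have := e i (Ordinal m0); rewrite !mxE /= i0 subn0.
have := e (Ordinal n0) j; rewrite !mxE /= j0 subn0.
exact: (can_inj (@conjCK C)).
Qed.

(** In each of the three cases, the form of [A] says that its diagonals [m]
    places apart have ratio [lambda], in the sense of [on_line]; the powers of
    [lambda] in the first column come from iterating this relation. *)
Lemma A_has_formP (a0 : C) a alpha lambda : (0 < m)%N -> (m < n)%N ->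
  cvcoef a 0 = 0 ->
  let S := diagseq a0 a alpha in
  A_has_form lambda a alpha a0 (toepmx a alpha + a0 *: rect_idmx n m) <->
  forall p : 'I_n, (0 < p)%N -> on_line lambda (S (p + m)%N) (S p).
Proof.
move=> m0 mn ha S; have n0 : (0 < n)%N by lia.
case: lambda => [x|] /=.
- case: (eqVneq x 0) => [->|x0].
    split=> [e p p0|H].
      have [ea _] := toepmx_inj _ _ _ _ _ n0 m0 e.
      by rewrite mul0r /S diagseq_col fullcoef_gt0 // ea // cvcoef0.
    have -> // : a = 0.
    apply: eq_cvcoef => [|i i0]; rewrite cvcoef0 //.
    by have := H i i0; rewrite /S mul0r diagseq_col fullcoef_gt0.
  rewrite toepmx_diagE toeplitz_with_diagmxP // -/S; split=> [[Hc Hr] p p0|H].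
  + rewrite Hc mxE; case: (ltnP p m) => pm.
      (* the diagonal [p] is read in the first row, at column [m - p] *)
      have hq : (m - p < m)%N by lia.
      have := Hr (Ordinal hq); rewrite mxE /= ifN; last lia.
      have -> : (m - (m - p) = p)%N by lia.
      move=> ->; rewrite divn_small // modn_small // expr0 mul1r.
      by rewrite fullcoef_gt0 // mulrA divff // mul1r.
    have hpm : (p - m < n)%N by have := ltn_ord p; lia.
    have := Hc (Ordinal hpm); rewrite mxE /= subnK // => ->.
    by rewrite -{1 2}(subnK pm) divnDr // divnn m0 addn1 modnDr exprS mulrA.
  + split=> [i|j]; rewrite mxE.
      have rec q r : (q * m + r < n)%N -> (r < m)%N ->
          S (q * m + r + m)%N = x ^+ q * fullcoef a0 a r.
        elim: q => [|q IHq] hn hr.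
          by rewrite mul0n add0n expr0 mul1r /S diagseq_col.
        have := H (Ordinal hn); rewrite /= => -> //; last by lia.
        have -> : (q.+1 * m + r = q * m + r + m)%N by lia.
        by rewrite IHq ?exprS ?mulrA //; lia.
      by rewrite -rec ?ltn_mod -?divn_eq.
    case: eqP => [->|/eqP j0].
      by rewrite subn0 -[X in S X]add0n /S diagseq_col.
    have hp : (m - j < n)%N by lia.
    have := ltn_ord j => hj.
    have := H (Ordinal hp); rewrite /= /S diagseq_col fullcoef_gt0; last lia.
    by move=> ->; [rewrite mulrA mulVf // mul1r|lia].
- rewrite toepmx_diagE toeplitz_with_diagmxP // -/S; split=> [[Hc Hr] p p0|H].
  + have := ltn_ord p => hp; case: (ltnP p m) => pm.
      have hq : (m - p < m)%N by lia.
      have := Hr (Ordinal hq); rewrite mxE /=.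
      by have -> : (m - (m - p) = p)%N by lia.
    have hpm : (p - m < n)%N by lia.
    by have := Hc (Ordinal hpm); rewrite mxE /= subnK // ifT //; lia.
  + split=> [i|j]; rewrite mxE.
      case: ifP => hi; last by rewrite /S diagseq_col.
      have hp : (i + m < n)%N by lia.
      by apply: (H (Ordinal hp)) => /=; lia.
    have := ltn_ord j => hj.
    have hp : (m - j < n)%N by lia.
    by apply: (H (Ordinal hp)) => /=; lia.
Qed.

End DiagSeq.

Section SecondFactor.
Context {m l : nat} (l0 : (0 < l)%N) (lm : (l <= m)%N).
Context {b : 'cV[C]_m} {beta : 'cV[C]_l} {b0 : C}.
Let B := toepmx b beta + b0 *: rect_idmx m l.
Let T := diagseq b0 b beta.

Let T_row (q : 'I_l) : (0 < q)%N -> T (l - q) = (cvcoef beta q)^*.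
Proof. by move=> q0; rewrite /T diagseq_row // q0 ltnW. Qed.

Let T_col (q : 'I_l) : (0 < q)%N -> T (m + (l - q)) = cvcoef b (m - q).
Proof.
move=> q0; have := ltn_ord q => hq.
have -> : (m + (l - q) = m - q + l)%N by lia.
by rewrite /T diagseq_col fullcoef_gt0 //; lia.
Qed.

Lemma cvcoef_hatv (q : 'I_l) : (0 < q)%N ->
  cvcoef (hatv l b) q = (cvcoef b (m - q))^*.
Proof. by move=> q0; rewrite cvcoefE mxE ifN // -lt0n. Qed.

Lemma cvcoef_hatv0 : cvcoef (hatv l b) 0 = 0.
Proof. by rewrite (cvcoefE _ _ (Ordinal l0)) mxE. Qed.

(** The entry [q] of [hat b] is conjugate to the diagonal [m - q] of [B], and
    that of [beta] to the diagonal [- q]: the form of [B] says that these two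
    diagonals have ratio [lambda], in the sense of [on_line]. *)
Lemma B_has_formP lambda : cvcoef beta 0 = 0 ->
  B_has_form lambda b beta b0 B <->
  forall q : 'I_l, (0 < q)%N -> on_line lambda (T (m + (l - q))) (T (l - q)).
Proof.
move=> hbeta; have m0 : (0 < m)%N by lia.
case: lambda => [x|] /=.
- case: (eqVneq x 0) => [->|x0].
    split=> [[h0 _] q q0|H].
      rewrite mul0r T_col //; apply: (can_inj (@conjCK C)).
      by rewrite -cvcoef_hatv // h0 cvcoef0 conjC0.
    split=> //; apply: eq_cvcoef => [|q q0]; rewrite cvcoef0 ?cvcoef_hatv0 //.
    by rewrite cvcoef_hatv // -T_col // H // mul0r conjC0.
  split=> [e q q0|H].
    have [_ eb] := toepmx_inj _ _ _ _ _ m0 l0 e.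
    rewrite T_col // T_row // eb // cvcoefZ cvcoef_hatv // rmorphM fmorphV /= !conjCK.
    by rewrite mulrA divff // mul1r.
  congr (toepmx b _ + _); apply: eq_cvcoef => [|q q0].
    by rewrite cvcoefZ cvcoef_hatv0 mulr0.
  rewrite cvcoefZ cvcoef_hatv // -T_col // H // T_row // rmorphM /= conjCK mulrA.
  by rewrite mulVf ?mul1r // conjC_eq0.
- split=> [e q q0|H].
    have [_ eb] := toepmx_inj _ _ _ _ _ m0 l0 e.
    by rewrite T_row // eb // cvcoef0 conjC0.
  congr (toepmx b _ + _); apply: eq_cvcoef => [|q q0]; rewrite cvcoef0 //.
  by apply: (can_inj (@conjCK C)); rewrite -T_row // H // conjC0.
Qed.

Lemma B_lower_bandedP :
  B_lower_banded b b0 B <->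
  forall q : 'I_l, (0 < q)%N -> T (m + (l - q)) = 0 /\ T (l - q) = 0.
Proof.
have m0 : (0 < m)%N by lia.
rewrite /B_lower_banded /B toepmx_diagE toeplitz_with_diagmxP // -/T.
split=> [[Hc Hr] q q0|H].
- have := ltn_ord q => hq; split; last first.
    by rewrite Hr mxE ifN // -lt0n.
  have hp : (m - q < m)%N by lia.
  have := Hc (Ordinal hp); rewrite mxE /= ifN; last lia.
  by have -> : (m - q + l = m + (l - q))%N by lia.
- split=> [i|j]; rewrite mxE.
    case: (leqP i (m - l)) => hi; first by rewrite /T diagseq_col.
    have hq : (m - i < l)%N by lia.
    have [] := H (Ordinal hq); rewrite /=; first by have := ltn_ord i; lia.
    by have -> : (m + (l - (m - i)) = i + l)%N by have := ltn_ord i; lia.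
  case: eqP => [->|/eqP j0].
    by rewrite subn0 -[X in T X]add0n /T diagseq_col.
  by have [] := H j; rewrite // lt0n.
Qed.

End SecondFactor.

(** * The theorem *)

(** For [m < n] every diagonal index is [p] or [p + m] for some [0 < p < n], so
    a nonzero matrix has a nonzero pair of diagonals. *)
Lemma diagmx_neq0 (n m : nat) S : (m < n)%N -> diagmx_of_seq n m S <> 0 ->
  exists2 p : 'I_n, (0 < p)%N & (S (p + m)%N != 0) || (S p != 0).
Proof.
move=> mn nz.
have [/exists_inP[p p0 h]|/exists_inPn H] :=
  boolP [exists (p : 'I_n | (0 < p)%N), (S (p + m)%N != 0) || (S p != 0)].
  by exists p.
have {}H (p : 'I_n) : (0 < p)%N -> S (p + m)%N = 0 /\ S p = 0.
  by move=> /(H p); rewrite negb_or !negbK => /andP[/eqP ? /eqP ?].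
case: nz; apply/matrixP => i j; rewrite !mxE.
have := ltn_ord i; have := ltn_ord j => hj hi.
case: (ltnP (i + (m - j)) n) => h.
  by have [] := H (Ordinal h); rewrite //=; lia.
have hp : (i + (m - j) - m < n)%N by lia.
have [] := H (Ordinal hp); rewrite /=; first by lia.
by rewrite subnK //; lia.
Qed.

End Toeplitz.

Theorem theorem3p6 (R : realType) (n m l k : nat)
    (hl : (0 < l)%N) (hlm : (l <= m)%N) (hmn : (m < n)%N)
    (hk : (0 < k)%N) (hkn : (k * m < n)%N) (hnk : (n <= k.+1 * m)%N)
    (A : 'M[R[i]]_(n, m)) (B : 'M[R[i]]_(m, l))
    (a : 'cV[R[i]]_n) (alpha : 'cV[R[i]]_m) (a0 : R[i])
    (b : 'cV[R[i]]_m) (beta : 'cV[R[i]]_l) (b0 : R[i])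
    (TA : is_toeplitz A) (nzA : A <> 0)
    (TB : is_toeplitz B) (nzB : B <> 0)
    (ha : cvcoef a 0 = 0) (halpha : cvcoef alpha 0 = 0)
    (hb : cvcoef b 0 = 0) (hbeta : cvcoef beta 0 = 0)
    (defA : A = toepmx a alpha + a0 *: rect_idmx n m)
    (defB : B = toepmx b beta + b0 *: rect_idmx m l) :
  is_toeplitz (A *m B) <->
    B_lower_banded b b0 B
    \/ exists lambda : option R[i],
         A_has_form lambda a alpha a0 A /\ B_has_form lambda b beta b0 B.
Proof.
move: nzA; rewrite defA defB {1}toepmx_diagE => nzS.
have m0 : (0 < m)%N by apply: leq_trans hlm.
rewrite (B_lower_bandedP hl hlm) {1}toepmx_diagE {1}toepmx_diagE is_toeplitz_mulP.
have [p p0 nzp] := diagmx_neq0 _ _ _ hmn nzS.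
have key := proportional_pairsP 'I_n 'I_l (fun p => 0 < p)%N (fun q => 0 < q)%N
  (fun p => diagseq a0 a alpha (p + m)) (fun p => diagseq a0 a alpha p)
  (fun q => diagseq b0 b beta (l - q)) (fun q => diagseq b0 b beta (m + (l - q)))
  (ex_intro2 _ _ p p0 nzp).
split=> [/key|].
- case=> [|[lambda [HA HB]]]; [by left|right; exists lambda].
  by rewrite A_has_formP // (B_has_formP hl hlm).
- case=> [H|[lambda [/A_has_formP HA /(B_has_formP hl hlm) HB]]]; apply/key.
    by left.
  by right; exists lambda; split; [exact: HA|exact: HB].
Qed.
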